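(* Let $\kappa$ be a regular uncountable cardinal and $\theta<\kappa$ a cardinal. Suppose that $c:[\kappa]^2\to\theta$ is a subadditive coloring witnessing $\mathrm{U}(\kappa,2,\theta,2)$. Then the following statements all hold. (1) For every cardinal $\mu<\kappa$, $c$ witnesses $\mathrm{U}(\kappa,\mu,\theta,2)$. If there exist no $\kappa$-Souslin trees, then $c$ moreover witnesses $\mathrm{U}(\kappa,\kappa,\theta,2)$. (2) For every cardinal $\mu\le\kappa$, if $c$ witnesses $\mathrm{U}(\kappa,\mu,\theta,2)$, then $c$ moreover witnesses $\mathrm{U}(\kappa,\mu,\theta,\mathrm{cf}(\theta))$. (3) For every infinite regular cardinal $\chi<\kappa$, if $c$ is $\Sigma$-closed for some stationary $\Sigma\subseteq E^\kappa_{\ge\chi}$, then $c$ witnesses $\mathrm{U}(\kappa,\kappa,\theta,\chi)$.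
   Context: $E^\kappa_{\ge\chi}=\{\alpha<\kappa\mid\mathrm{cf}(\alpha)\ge\chi\}$. For a set $a$ of ordinals: $\mathrm{ssup}(a)=\sup\{\alpha+1\mid\alpha\in a\}$, $\mathrm{acc}^+(a)=\{\alpha<\mathrm{ssup}(a)\mid \sup(a\cap\alpha)=\alpha>0\}$. For sets of ordinals, $a<b$ means every element of $a$ is below every element of $b$. For $c:[\kappa]^2\to\theta$ write $c(\alpha,\beta)$ for $c(\{\alpha,\beta\})$, $\alpha<\beta$. $\mathrm{U}(\kappa,\mu,\theta,\chi)$: a coloring $c:[\kappa]^2\to\theta$ witnesses it if for every $\sigma<\chi$, every pairwise disjoint $\mathcal A\subseteq[\kappa]^\sigma$ with $|\mathcal A|=\kappa$, and every $i<\theta$, there is $\mathcal B\subseteq\mathcal A$ with $|\mathcal B|=\mu$ such that $\min(c[a\times b])>i$ for all $a,b\in\mathcal B$ with $a<b$. $c$ is subadditive if for all $\alpha<\beta<\gamma<\kappa$: $c(\alpha,\gamma)\le\max\{c(\alpha,\beta),c(\beta,\gamma)\}$ and $c(\alpha,\beta)\le\max\{c(\alpha,\gamma),c(\beta,\gamma)\}$. With $D^c_{\le i}(\beta)=\{\alpha<\beta\mid c(\alpha,\beta)\le i\}$, $c$ is $\Sigma$-closed if $\mathrm{acc}^+(D^c_{\le i}(\beta))\cap\Sigma\subseteq D^c_{\le i}(\beta)$ for all $\beta<\kappa$, $i\le\theta$. A $\kappa$-Souslin tree is a tree of size $\kappa$ with no chains and no antichains of size $\kappa$. *)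

(* Defs.v *)
From HB Require Import structures.
From mathcomp Require Import all_boot all_order.
From mathcomp Require Import boolp classical_sets functions cardinality wochoice.

Set Implicit Arguments.
Unset Strict Implicit.
Unset Printing Implicit Defensive.

Import Order.TTheory.
Local Open Scope order_scope.
Local Open Scope classical_set_scope.
Local Open Scope card_scope.

(** Ordinals are the elements of a well-ordered type [O] with bottom [\bot],
    which plays the role of 0.  Up to isomorphism such an [O] is an arbitrary
    nonzero ordinal.  The von Neumann ordinal "α = set of its predecessors" is
    [below α].  No ordinal larger than the given κ is ever needed, so [O] need
    not be closed under any operation. *)

Section Ordinals.
Context {d : Order.disp_t} {O : bOrderType d}.
Implicit Types (a b A C S : set O) (i s κ μ θ χ σ : O).

Definition below κ : set O := [set α | α < κ].

(** α + 1, provided α is not the top element of [O]. *)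
Definition osucc (α : O) : O := infimum \bot [set β | α < β].

Definition two : O := osucc (osucc \bot).

(** Genuine suprema for sets bounded in [O]; in particular [osup set0 = \bot]. *)
Definition osup a : O := supremum \bot a.

Definition ssup a : O := osup (osucc @` a).

Definition accp a : set O :=
  [set α | α < ssup a /\ osup (a `&` below α) = α /\ \bot < α].

Definition cardinal κ : Prop := forall α, α < κ -> ~ (below α #= below κ).

(** cf(α) is the least β carrying a map β -> α with cofinal range; thus
    cf(0) = 0 and cf(α + 1) = 1.  The set below contains α. *)
Definition cof (α : O) : O :=
  infimum \bot [set β | exists f : O -> O,
    (forall η, η < β -> f η < α) /\
    (forall ξ, ξ < α -> exists2 η, η < β & ξ <= f η)].

Definition infinite_regular_cardinal κ : Prop :=
  [/\ cardinal κ, infinite_set (below κ) & cof κ = κ].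

Definition E_ge κ χ : set O := [set α | α < κ /\ χ <= cof α].

Definition club κ C : Prop :=
  [/\ C `<=` below κ,
      (forall α, α < κ -> exists2 β, C β & α < β) &
      (forall α, α < κ -> \bot < α -> osup (C `&` below α) = α -> C α)].

Definition stationary κ S : Prop :=
  S `<=` below κ /\ forall C, club κ C -> (S `&` C) !=set0.

Definition set_lt a b : Prop := forall α β, a α -> b β -> α < β.

(** [κ]^σ *)
Definition subsets_of_card κ σ : set (set O) :=
  [set a | a `<=` below κ /\ a #= below σ].

(** A map [κ]^2 -> θ is represented by a binary function [c] of which only the
    values [c α β] with α < β < κ matter. *)
Definition coloring κ θ (c : O -> O -> O) : Prop :=
  forall α β, α < β -> β < κ -> c α β < θ.

Definition witnesses_U κ μ θ χ (c : O -> O -> O) : Prop :=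
  forall σ, cardinal σ -> σ < χ ->
  forall A : set (set O), A `<=` subsets_of_card κ σ ->
    trivIset A id -> A #= below κ ->
  forall i, i < θ ->
  exists B : set (set O),
    [/\ B `<=` A, B #= below μ &
        forall a b, B a -> B b -> set_lt a b ->
          forall α β, a α -> b β -> i < c α β].

Definition subadditive κ (c : O -> O -> O) : Prop :=
  forall α β γ, α < β -> β < γ -> γ < κ ->
    c α γ <= Order.max (c α β) (c β γ) /\
    c α β <= Order.max (c α γ) (c β γ).

Definition D_le (c : O -> O -> O) i (β : O) : set O :=
  [set α | α < β /\ c α β <= i].

Definition closed_for κ θ S (c : O -> O -> O) : Prop :=
  forall β i, β < κ -> i <= θ -> accp (D_le c i β) `&` S `<=` D_le c i β.

End Ordinals.

Section Trees.
Variables (T : Type) (lt : T -> T -> Prop).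

Definition is_tree : Prop :=
  [/\ (forall x, ~ lt x x),
      (forall x y z, lt x y -> lt y z -> lt x z) &
      (* the set of predecessors of each node is well-ordered by [lt] *)
      (forall x (A : set T), A `<=` [set y | lt y x] -> A !=set0 ->
        exists2 m, A m & forall y, A y -> y = m \/ lt m y)].

Definition tree_chain (A : set T) : Prop :=
  forall x y, A x -> A y -> [\/ x = y, lt x y | lt y x].

Definition tree_antichain (A : set T) : Prop :=
  forall x y, A x -> A y -> x <> y -> ~ lt x y /\ ~ lt y x.

Definition souslin_tree d (O : bOrderType d) (κ : O) : Prop :=
  [/\ is_tree, [set: T] #= below κ,
      (forall A, tree_chain A -> ~ (A #= below κ)) &
      (forall A, tree_antichain A -> ~ (A #= below κ))].

End Trees.

(* Main.v *)
Require Import Defs.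
From mathcomp Require Import all_boot all_order.
From mathcomp Require Import boolp classical_sets functions cardinality wochoice.

Set Implicit Arguments.
Unset Strict Implicit.
Unset Printing Implicit Defensive.

Import Order.TTheory.
Local Open Scope order_scope.
Local Open Scope classical_set_scope.
Local Open Scope card_scope.

(** Fix a color i and read c α β <= i (for α < β) as a relation between α and
    β.  The two halves of subadditivity say that this relation is transitive
    and that the predecessors of a point are pairwise related, so it is a tree
    order on κ refining <.  The hypothesis U(κ,2,θ,2) says that this tree has no
    chain of size κ, even after restriction to a set of size κ; a family of
    pairwise unrelated points is a set on which c exceeds i, so the claims on
    U(κ,μ,θ,2) ask for antichains of size μ.

    Part (1).  A tree of size κ without chains and antichains of size κ is a
    κ-Souslin tree, which gives the second claim (node_souslin).  The first
    claim, small_antichain, is proved by contradiction from an unbounded P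
    without antichains of size μ.  Call the trace of β below δ its set of tree
    predecessors in P below δ.  Points above δ with different traces below δ are
    unrelated, so there are few traces below each δ.  Some trace below δ is
    therefore shared by unboundedly many points (exists_big); every such trace
    splits at a higher level, since otherwise the points sharing it contain a
    large chain or a large antichain (big_splits); and one level above δ suffices
    for splitting all of them (split_bound).  Go through μ levels like that, and
    take a point β above them all, with a trace shared by unboundedly many
    points: splitting off the branch of β once between each two levels gives μ
    many points with pairwise different traces, an antichain.

    Part (2), U_cofinality.  To each γ attach a member a of the family lying
    above γ.  As a has fewer than cf(θ) elements, c(γ,·) is bounded on a by some
    j < θ, and the same j >= i serves unboundedly many γ.  Where c exceeds j on
    pairs of such γ, subadditivity makes c exceed j between the attached sets.

    Part (3), U_closed.  It is enough to attach to unboundedly many γ a member a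
    of the family above γ such that, for all α in a, the tree predecessors of α
    below γ lie below a bound ε not depending on γ: a sequence of such sets,
    spaced apart, has all colors above i.  For γ in the stationary set, whose
    cofinality exceeds the size of a, a bound ε < γ exists as soon as no α in a
    has its predecessors cofinal in γ; a pressing-down argument makes ε
    constant.  If this failed for unboundedly many γ, part (1) would give χ many
    of them that are pairwise unrelated; a single a above them all, of size
    less than χ, would then contain for each such γ some α whose predecessors
    are cofinal in γ.  By closedness at most two such γ share their α, which
    contradicts the size of a (avoids_tail). *)

(** * Cardinality *)

Section Cardinality.
Context {T U : Type}.
Implicit Types (A : set T) (B : set U).

Lemma card_eq_enum (u : U) A B : A #= B ->
  exists f : T -> U, [/\ forall x, A x -> B (f x),
    forall x y, A x -> A y -> f x = f y -> x = y &
    forall b, B b -> exists2 x, A x & f x = b].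
Proof.
move=> /card_bijP[g [g' gK g'K]].
pose f x := if pselect (A x) is left h then val (g (SigSub (mem_set h))) else u.
have fE x (h : A x) : f x = val (g (SigSub (mem_set h))).
  by rewrite /f; case: pselect => // h'; rewrite (Prop_irrelevance h h').
exists f; split.
- by move=> x Ax; rewrite (fE _ Ax); apply/set_mem/valP.
- move=> x y Ax Ay; rewrite (fE _ Ax) (fE _ Ay) => /val_inj/(can_inj gK).
  by move=> /(congr1 val).
- move=> b Bb; pose x := g' (SigSub (mem_set Bb)).
  have Ax : A (val x) by apply/set_mem/valP.
  exists (val x) => //; rewrite (fE _ Ax).
  rewrite (_ : SigSub _ = x) ?g'K //; exact: val_inj.
Qed.

Lemma card_le_inj A B (f : T -> U) : (forall x, A x -> B (f x)) ->
  (forall x y, A x -> A y -> f x = f y -> x = y) -> A #<= B.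
Proof.
move=> fB fI; apply: (@card_le_trans _ _ _ (f @` A)); last first.
  by apply: subset_card_le => _ [x Ax <-]; exact: fB.
have : f @` A #= A.
  by apply: inj_card_eq => x y /set_mem Ax /set_mem Ay; exact: fI.
by rewrite card_eq_le => /andP[].
Qed.

End Cardinality.

(** * Well-ordered types *)

Section Ordinals.
Context {d : Order.disp_t} {O : bOrderType d}.
Context (wfO : well_order (<=%O : rel O)).
Implicit Types (P S : set O) (α β γ δ ε ξ η κ μ : O).

Lemma exists_least P : P !=set0 -> exists2 m, P m & forall x, P x -> m <= x.
Proof.
move=> [x Px]; have [|m [[mP mle] _]] := wfO (A := [pred x | `[< P x >]]).
  by exists x; rewrite inE.
exists m; first by move: mP; rewrite inE.
by move=> y Py; apply: mle; rewrite inE.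
Qed.

Lemma ord_wf : well_founded (fun ξ η : O => ξ < η).
Proof.
move=> η; apply: contrapT => nacc.
have [|m nm mle] := @exists_least [set x | ~ Acc (fun ξ η : O => ξ < η) x].
  by exists η.
apply: nm; constructor => y ym; apply: contrapT => ny.
by move: ym; rewrite ltNge (mle _ ny).
Qed.

Lemma infimum_least P m : P m -> (forall x, P x -> m <= x) ->
  infimum \bot P = m.
Proof.
move=> Pm mle; rewrite /infimum; case: ifPn => [/eqP P0|_].
  by move: Pm; rewrite P0.
apply: xget_unique; first by split=> // y; apply.
move=> y [yl yg]; apply: le_anti; rewrite (yl _ Pm) /=; exact: (yg _ mle).
Qed.

Lemma osup_unique P m : (forall x, P x -> x <= m) ->
  (forall b, (forall x, P x -> x <= b) -> m <= b) -> osup P = m.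
Proof.
move=> mu mle; rewrite /osup /supremum; case: ifPn => [/eqP P0|_].
  by apply: le_anti; rewrite le0x mle // => x; rewrite P0.
apply: xget_unique; first by split=> // y; apply.
move=> y [yl yg]; apply: le_anti; rewrite (yg _ mu) /= ; exact: (mle _ yl).
Qed.

Lemma osup_lub P b : (forall x, P x -> x <= b) ->
  (forall x, P x -> x <= osup P) /\
  (forall b', (forall x, P x -> x <= b') -> osup P <= b').
Proof.
move=> Pb; have [|m mub mle] := @exists_least [set y | forall x, P x -> x <= y].
  by exists b.
by rewrite (@osup_unique P m).
Qed.

Lemma osucc_le α β : α < β -> α < osucc α /\ osucc α <= β.
Proof.
move=> ab; have [|m am mle] := @exists_least [set β | α < β]; first by exists β.
by rewrite /osucc (infimum_least am mle); split=> //; exact: mle.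
Qed.

Lemma lt_osucc α β : α < β -> α < osucc α.
Proof. by move=> /osucc_le[]. Qed.

Lemma osucc_lub α β : α < β -> osucc α <= β.
Proof. by move=> /osucc_le[]. Qed.

Lemma lt_osuccE α β γ : α < γ -> (β < osucc α) = (β <= α).
Proof.
move=> /osucc_le[aS _]; apply/idP/idP => [|/le_lt_trans]; last exact.
by move=> bS; rewrite leNgt; apply/negP => /osucc_lub; rewrite leNgt bS.
Qed.

Lemma cof_minimal α β (f : O -> O) : (forall η, η < β -> f η < α) ->
  (forall ξ, ξ < α -> exists2 η, η < β & ξ <= f η) -> cof α <= β.
Proof.
move=> fα fcof.
set B := [set β | exists f : O -> O, (forall η, η < β -> f η < α) /\
    (forall ξ, ξ < α -> exists2 η, η < β & ξ <= f η)].
have Bβ : B β by exists f.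
have [|m Bm mle] := @exists_least B; first by exists β.
by rewrite /cof (infimum_least Bm mle); exact: mle.
Qed.

Lemma cof_le α : cof α <= α.
Proof. by apply: (@cof_minimal _ _ id) => // ξ xa; exists ξ. Qed.

Lemma lt_cof_bounded α β (f : O -> O) : β < cof α ->
  (forall η, η < β -> f η < α) ->
  exists2 ε, ε < α & forall η, η < β -> f η < ε.
Proof.
move=> bcof fa; apply: contrapT => nb.
suff: cof α <= β by rewrite leNgt bcof.
apply: (cof_minimal fa) => ξ xa; apply: contrapT => nx; apply: nb; exists ξ => //.
by move=> η eb; rewrite ltNge; apply/negP => xf; apply: nx; exists η.
Qed.

(** Transfinite recursion with choices: a condition on each new term relative to
    the earlier ones can be met along all of κ if it can be met at every stage. *)
Lemma transfinite_sequence (X : Type) (x0 : X) κ (P : set X)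
    (R : X -> X -> Prop) :
  (forall η, η < κ -> forall f : O -> X, (forall ξ, ξ < η -> P (f ξ)) ->
     exists2 t, P t & forall ξ, ξ < η -> R (f ξ) t) ->
  exists f : O -> X, forall η, η < κ ->
    P (f η) /\ forall ξ, ξ < η -> R (f ξ) (f η).
Proof.
move=> step.
have /choice[G GP] : forall p : O * (O -> X), exists t, p.1 < κ ->
    (forall ξ, ξ < p.1 -> P (p.2 ξ)) ->
    P t /\ forall ξ, ξ < p.1 -> R (p.2 ξ) t.
  move=> [η f] /=; have [ek|] := boolP (η < κ); last by exists x0.
  have [fP|nfP] := pselect (forall ξ, ξ < η -> P (f ξ)); last by exists x0.
  by have [t Pt Rt] := step _ ek f fP; exists t.
pose F η (rec : forall ξ, ξ < η -> X) : X :=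
  G (η, fun ξ => if pselect (ξ < η) is left h then rec ξ h else x0).
pose f : O -> X := Fix ord_wf (fun=> X) F.
have fE η : f η = G (η, fun ξ => if pselect (ξ < η) then f ξ else x0).
  rewrite {1}/f Fix_eq => [|x u v uv]; rewrite /F; congr (G (_, _)).
    by apply/funext => y; case: pselect.
  by apply/funext => y; case: pselect => // h; exact: uv.
exists f => η; elim/(well_founded_ind ord_wf): η => η IH ek.
have := GP (η, fun ξ => if pselect (ξ < η) then f ξ else x0) ek; rewrite -fE /=.
move=> [|Pf Rf].
  move=> ξ xe; case: pselect => [?|//]; by case: (IH _ xe (lt_trans xe ek)).
by split=> // ξ xe; have := Rf _ xe; case: pselect.
Qed.

(** The source of all long sequences below.  Fewer than cf(κ) = κ many values of
    [g] are bounded, so the unbounded [h] can jump over them.  The terms have an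
    arbitrary type because sets, and pairs of a point and a set, occur. *)
Lemma increasing_sequence (X : Type) (x0 : X) κ (P : set X) (h g : X -> O) :
  cof κ = κ -> (forall t, P t -> g t < κ) ->
  (forall ε, ε < κ -> exists2 t, P t & ε < h t) ->
  exists f : O -> X, (forall η, η < κ -> P (f η)) /\
    forall ξ η, ξ < η -> η < κ -> g (f ξ) < h (f η).
Proof.
move=> kreg gk hunb.
have [|f fP] := @transfinite_sequence X x0 κ P (fun t t' => g t < h t').
  move=> η ek f fP.
  have [||ε epsk fe] := @lt_cof_bounded κ η (g \o f).
  - by rewrite kreg.
  - by move=> ξ /fP /gk.
  have [t Pt et] := hunb _ epsk; exists t => // ξ /fe gf; exact: lt_trans et.
exists f; split=> [η /fP[]//|ξ η xe /fP[_]]; exact.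
Qed.

Definition unbounded κ P := forall ε, ε < κ -> exists2 γ, P γ & ε < γ.

Lemma not_unbounded κ P : ~ unbounded κ P ->
  exists2 ε, ε < κ & forall γ, P γ -> γ <= ε.
Proof.
move=> /existsNP[ε /not_implyP[ek ne]]; exists ε => // γ Pg.
by rewrite leNgt; apply/negP => eg; apply: ne; exists γ.
Qed.


(** * Regular cardinals *)

Section RegularCardinal.
Variable κ : O.
Hypothesis κ_regular : infinite_regular_cardinal κ.

Let κ_card : cardinal κ. Proof. by case: κ_regular. Qed.
Let κ_cof : cof κ = κ. Proof. by case: κ_regular. Qed.

Lemma regular_bounded β (f : O -> O) : β < κ ->
  (forall η, η < β -> f η < κ) ->
  exists2 ε, ε < κ & forall η, η < β -> f η < ε.
Proof. by move=> bk; apply: lt_cof_bounded; rewrite κ_cof. Qed.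

Lemma one_lt_regular : osucc \bot < κ.
Proof.
have [_ κ_inf _] := κ_regular.
have k0 : \bot < κ.
  rewrite lt0x; apply/eqP => k0; apply: κ_inf.
  suff -> : below κ = set0 by exact: finite_set0.
  by apply/seteqP; split=> x //=; rewrite /below /= k0 ltx0.
rewrite lt_neqAle osucc_lub // andbT; apply/eqP => k1; apply: κ_inf.
apply: (@sub_finite_set _ _ [set \bot]); last exact: finite_set1.
by move=> x; rewrite /below /= -k1 (lt_osuccE _ k0) lex0 => /eqP.
Qed.

Lemma bot_lt_regular : \bot < κ.
Proof. by rewrite (le_lt_trans (le0x (osucc \bot))) // one_lt_regular. Qed.

Lemma osucc_lt_regular α : α < κ -> osucc α < κ.
Proof.
move=> ak; have [//|ε ek /(_ \bot)] :=
  @regular_bounded (osucc \bot) (fun=> α) one_lt_regular.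
rewrite (lt_osuccE _ bot_lt_regular) lexx => /(_ isT) ae.
exact: le_lt_trans (osucc_lub ae) ek.
Qed.

Lemma not_card_le_below μ : μ < κ -> ~ (below κ #<= below μ).
Proof.
move=> mk km; apply: (κ_card mk); apply/card_eqPle; split=> //.
by apply: subset_card_le => x /lt_trans; apply.
Qed.

Lemma unbounded_enum P : P `<=` below κ -> unbounded κ P ->
  exists f : O -> O, (forall η, η < κ -> P (f η)) /\
    forall ξ η, ξ < η -> η < κ -> f ξ < f η.
Proof. by move=> Pk Pu; exact: (@increasing_sequence O \bot κ P id id). Qed.

Lemma increasing_inj (f : O -> O) μ :
  (forall ξ η, ξ < η -> η < μ -> f ξ < f η) ->
  forall ξ η, ξ < μ -> η < μ -> f ξ = f η -> ξ = η.
Proof.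
move=> finc ξ η xm em fe; case: (ltgtP ξ η) => // xe.
- by move: (finc _ _ xe em); rewrite fe ltxx.
- by move: (finc _ _ xe xm); rewrite fe ltxx.
Qed.

Lemma unbounded_card P : P `<=` below κ -> unbounded κ P -> P #= below κ.
Proof.
move=> Pk Pu; apply/card_eqPle; split; first exact: subset_card_le.
have [f [fP finc]] := unbounded_enum Pk Pu.
apply: (card_le_inj fP); exact: increasing_inj.
Qed.

Lemma card_unbounded P : P `<=` below κ -> below κ #<= P -> unbounded κ P.
Proof.
move=> Pk kP ε ek; apply: contrapT => nP.
apply: (not_card_le_below (osucc_lt_regular ek)).
apply: (card_le_trans kP); apply: subset_card_le => x Px /=.
rewrite /below /= (lt_osuccE _ ek) leNgt; apply/negP => ex.
by apply: nP; exists x.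
Qed.

Section Family.
Variables (σ : O) (A : set (set O)).
Hypotheses (σ_lt : σ < κ) (A_sub : A `<=` subsets_of_card κ σ)
  (A_triv : trivIset A id) (A_card : A #= below κ).

(** If one member is empty then so are all, being equinumerous; but then the
    family has at most one member. *)
Lemma family_nonempty a : A a -> a !=set0.
Proof.
move=> Aa; apply/set0P/eqP => a0; case: κ_regular => _ κ_inf _; apply: κ_inf.
have A1 : A `<=` [set set0].
  move=> b Ab; apply/eqP; rewrite -(@card_eq0 _ O).
  apply: (card_eq_trans (A_sub Ab).2); rewrite -a0.
  exact: card_esym (A_sub Aa).2.
apply: (@card_le_finite _ _ _ [set set0 : set O]); last exact: finite_set1.
apply: card_le_trans (subset_card_le A1).
by move: A_card; rewrite card_eq_le => /andP[].
Qed.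

(** Otherwise picking from each member a point not above ε injects the family,
    by disjointness, into a proper initial segment of κ. *)
Lemma family_unbounded ε : ε < κ ->
  exists2 a, A a & forall α, a α -> ε < α.
Proof.
move=> ek; apply: contrapT => nA.
have /choice[f fP] : forall a, exists x, A a -> a x /\ x <= ε.
  move=> a; have [Aa|] := pselect (A a); last by exists \bot.
  apply: contrapT => na; apply: nA; exists a => // α aα.
  by rewrite ltNge; apply/negP => ae; apply: na; exists α.
apply: (not_card_le_below (osucc_lt_regular ek)).
apply: (@card_le_trans _ _ _ A).
  by move: A_card; rewrite card_eq_le => /andP[].
apply: (@card_le_inj _ _ _ _ f).
- by move=> a /fP[_]; rewrite /below /= (lt_osuccE _ ek).
- move=> a b Aa Ab fab; apply: A_triv => //; exists (f a); split.
    by case: (fP _ Aa).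
  by rewrite fab; case: (fP _ Ab).
Qed.

Lemma family_enum a : A a -> exists e : O -> O,
  (forall η, η < σ -> a (e η)) /\ forall α, a α -> exists2 η, η < σ & e η = α.
Proof.
by move=> /A_sub[_ /card_esym /(card_eq_enum \bot)[e [ea _ es]]]; exists e.
Qed.

Lemma family_bounded_in λ a (f : O -> O) : σ < cof λ -> A a ->
  (forall α, a α -> f α < λ) -> exists2 ε, ε < λ & forall α, a α -> f α < ε.
Proof.
move=> sl Aa fl; have [e [ea es]] := family_enum Aa.
have [|ε el fe] := @lt_cof_bounded λ σ (f \o e) sl.
  by move=> η /ea /fl.
by exists ε => // α /es[η es' <-]; exact: fe.
Qed.

Lemma family_bounded a : A a -> exists2 ε, ε < κ & forall α, a α -> α < ε.
Proof.
move=> Aa; apply: (@family_bounded_in κ a id) => //; first by rewrite κ_cof.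
by case: (A_sub Aa).
Qed.

End Family.

Lemma unbounded_split P : unbounded κ (below κ `&` P) \/
  unbounded κ (below κ `\` P).
Proof.
apply: contrapT => /not_orP[/not_unbounded[ε ek Pe] /not_unbounded[ε' ek' Pe']].
have mk : Order.max ε ε' < κ by rewrite gt_max ek ek'.
have sk := osucc_lt_regular mk; have := lt_osucc mk; rewrite gt_max => /andP[es es'].
have [Ps|nPs] := pselect (P (osucc (Order.max ε ε'))).
  by have := Pe _ (conj sk Ps); rewrite leNgt es.
by have := Pe' _ (conj sk nPs); rewrite leNgt es'.
Qed.

(** An unbounded subset of a regular cardinal has full size. *)
Lemma unbounded_not_card_le (X : Type) (a : set X) (f : O -> X) P σ :
  P `<=` below κ -> unbounded κ P -> σ < κ -> a #= below σ ->
  (forall η, P η -> a (f η)) ->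
  (forall ξ η, P ξ -> P η -> f ξ = f η -> ξ = η) -> False.
Proof.
move=> Pk Pu sk as_ fa fI; apply: (not_card_le_below sk).
apply: (@card_le_trans _ _ _ a).
  apply: card_le_trans (card_le_inj fa fI).
  by have := unbounded_card Pk Pu; rewrite card_eq_le => /andP[].
by move: as_; rewrite card_eq_le => /andP[].
Qed.

(** In a sequence of successively higher nonempty sets, comparing two terms
    recovers the order of their indices. *)
Lemma set_lt_index (a : O -> set O) : (forall η, η < κ -> a η !=set0) ->
  (forall ξ η, ξ < η -> η < κ -> set_lt (a ξ) (a η)) ->
  forall ξ η, ξ < κ -> η < κ -> set_lt (a ξ) (a η) -> ξ < η.
Proof.
move=> a0 alt ξ η xk ek ale; have [x ax] := a0 _ xk; have [y ay] := a0 _ ek.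
have xy := ale _ _ ax ay.
case: (ltgtP ξ η) => // [ex|xe].
  by have := lt_trans xy (alt _ _ ex xk _ _ ay ax); rewrite ltxx.
by move: ale; rewrite -xe => /(_ _ _ ax ax); rewrite ltxx.
Qed.

Lemma set_lt_injective (a : O -> set O) : (forall η, η < κ -> a η !=set0) ->
  (forall ξ η, ξ < η -> η < κ -> set_lt (a ξ) (a η)) ->
  forall ξ η, ξ < κ -> η < κ -> a ξ = a η -> ξ = η.
Proof.
move=> a0 alt ξ η xk ek ae; have [x ax] := a0 _ xk.
case: (ltgtP ξ η) => // xe.
  by have := alt _ _ xe ek x x ax; rewrite -ae ltxx => /(_ ax).
by have := alt _ _ xe xk x x; rewrite -ae ltxx => /(_ ax ax).
Qed.

(** * Closed unbounded sets and pressing down *)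

Section Uncountable.
Hypothesis κ_uncountable : ~ countable (below κ).

Lemma sequence_bounded (u : nat -> O) : (forall n, u n < κ) ->
  exists2 ε, ε < κ & forall n, u n < ε.
Proof.
move=> uk; apply: contrapT => nb.
have ucof ε : ε < κ -> exists n, ε <= u n.
  move=> ek; apply: contrapT => ne; apply: nb; exists ε => // n.
  by rewrite ltNge; apply/negP => eu; apply: ne; exists n.
apply: κ_uncountable.
(* Were all proper initial segments of κ finite, the cofinal sequence [u] would
   exhibit κ as a countable union of finite sets; and an infinite one makes [u]
   a sequence of length less than κ. *)
suff bfin n : finite_set (below (osucc (u n))).
  apply: (@sub_countable _ _ _ (\bigcup_n below (osucc (u n)))).
    apply: subset_card_le => x /ucof[n xu]; exists n => //.
    by rewrite /below /= (lt_osuccE _ (uk n)).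
  by apply: bigcup_countable => // n _; exact: finite_set_countable.
apply: contrapT => /infiniteP/card_leP[j]; apply: nb.
pose j' m := val (j (SigSub (mem_setT m))).
have jI m m' : j' m = j' m' -> m = m'.
  by move=> /val_inj /(inj) /(congr1 val) /=; apply; rewrite inE.
have /choice[w wP] : forall x, exists m, forall m', j' m' = x -> m = m'.
  move=> x; have [[m mx]|nx] := pselect (exists m, j' m = x).
    by exists m => m' m'x; apply: jI; rewrite mx.
  by exists 0%N => m' m'x; case: nx; exists m'.
have [|ε ek we] := @regular_bounded _ (u \o w) (osucc_lt_regular (uk n)).
  by move=> η _; exact: uk.
exists ε => // m; have /= := we (j' m); rewrite (wP _ m) //; apply.
by have /set_mem := valP (j (SigSub (mem_setT m))).
Qed.

(** Unboundedness is obtained by iterating ω times a function that exceeds [h] on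
    an initial segment, and taking the least strict upper bound of the iterates. *)
Lemma closure_club ρ (h : O -> O) : ρ < κ -> (forall ε, ε < κ -> h ε < κ) ->
  club κ [set δ | [/\ δ < κ, ρ < δ & forall ε, ε < δ -> h ε < δ]].
Proof.
move=> rk hk; split=> [δ []//|β bk|α ak a0 asup].
- have /choice[k kP] : forall δ, exists δ', δ < κ ->
      [/\ δ' < κ, δ < δ' & forall ε, ε <= δ -> h ε < δ'].
    move=> δ; have [dk|] := boolP (δ < κ); last by exists \bot.
    have [|δ' d'k hd'] := @regular_bounded _ h (osucc_lt_regular dk).
      by move=> η /lt_trans/(_ (osucc_lt_regular dk))/hk.
    have mk : Order.max δ δ' < κ by rewrite gt_max dk d'k.
    exists (osucc (Order.max δ δ')) => _; split; first exact: osucc_lt_regular.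
      by rewrite (lt_osuccE _ mk) le_max lexx.
    move=> ε ed; rewrite (lt_osuccE _ mk) le_max (ltW (hd' _ _)) ?orbT //.
    by rewrite (lt_osuccE _ dk).
  pose u n := iter n k (Order.max β ρ).
  have uk n : u n < κ.
    by elim: n => [|n /kP[]//]; rewrite gt_max bk rk.
  have [ε ek ue] := sequence_bounded uk.
  have [|δ ud dle] := @exists_least [set y | forall n, u n < y]; first by exists ε.
  have := ud 0%N; rewrite gt_max => /andP[bd rd].
  exists δ => //; split=> // [|ξ xd]; first exact: le_lt_trans (dle _ ue) ek.
  have [n xu] : exists n, ξ <= u n.
    apply: contrapT => nn; have := dle ξ; rewrite leNgt xd => H.
    have // : false; apply: H => n; rewrite ltNge; apply/negP => xu.
    by apply: nn; exists n.
  by apply: lt_trans (ud n.+1); have [_ _] := kP _ (uk n); exact.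
- have cofinal b : b < α -> exists x, [/\ x < α, b < x, ρ < x &
      forall ε, ε < x -> h ε < x].
    move=> ba; apply: contrapT => nx; have := ba.
    rewrite ltNge -{1}asup => /negP; apply.
    set B := (_ `&` _); have [|_ ->//] := @osup_lub B α.
      by move=> x [_ /ltW].
    move=> x [[_ rx hx] xa]; rewrite leNgt; apply/negP => bx.
    by apply: nx; exists x.
  split=> // [|ε /cofinal[x [xa ex _ hx]]]; last exact: lt_trans (hx _ ex) xa.
  by have [x [xa _ rx _]] := cofinal _ a0; exact: lt_trans xa.
Qed.

(** A weak form of Fodor's lemma, with an unbounded set in place of a stationary
    one.  If [h ε] bounds the points where [f] is at most [ε], then the stationary
    set meets the club of closure points of [h], where [f] cannot be regressive. *)
Lemma pressing_down_bounded S ρ (f : O -> O) : stationary κ S -> ρ < κ ->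
  (forall γ, S γ -> ρ < γ -> f γ < γ) ->
  exists2 ε, ε < κ & unbounded κ [set γ | [/\ S γ, ρ < γ & f γ <= ε]].
Proof.
move=> [Sk Sstat] rk freg; apply: contrapT => ne.
have /choice[h hP] : forall ε, exists ζ, ε < κ -> ζ < κ /\
    forall γ, S γ -> ρ < γ -> f γ <= ε -> γ <= ζ.
  move=> ε; have [ek|] := boolP (ε < κ); last by exists \bot.
  have [|ζ zk zP] := @not_unbounded κ [set γ | [/\ S γ, ρ < γ & f γ <= ε]].
    by move=> eu; apply: ne; exists ε.
  by exists ζ => _; split=> // γ Sg rg fg; exact: zP.
have [|γ [Sg [gk rg hg]]] := Sstat _ (@closure_club ρ h rk _).
  by move=> ε /hP[].
have fg := freg _ Sg rg; have [_ /(_ _ Sg rg (lexx _))] := hP _ (lt_trans fg gk).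
by rewrite leNgt hg.
Qed.

End Uncountable.

(** * The principle U for singletons *)

Section Coloring.
Variables (θ : O) (c : O -> O -> O).

Lemma witnesses_U_of_sequence μ χ :
  (forall σ, cardinal σ -> σ < χ -> forall A, A `<=` subsets_of_card κ σ ->
     trivIset A id -> A #= below κ -> forall i, i < θ ->
     exists f : O -> set O, [/\ forall η, η < μ -> A (f η),
       forall ξ η, ξ < μ -> η < μ -> f ξ = f η -> ξ = η &
       forall ξ η, ξ < μ -> η < μ -> set_lt (f ξ) (f η) ->
         forall α β, f ξ α -> f η β -> i < c α β]) ->
  witnesses_U κ μ θ χ c.
Proof.
move=> H σ cσ sc A As At Ac i it; have [f [fA fI fc]] := H σ cσ sc A As At Ac i it.
exists (f @` below μ); split.
- by move=> _ [η em <-]; exact: fA.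
- by apply: inj_card_eq => x y /set_mem xm /set_mem ym; exact: fI.
- by move=> _ _ [ξ xm <-] [η em <-]; exact: fc.
Qed.

(** The instance of U(κ,μ,θ,2) for the family of singletons of [P], with the
    singletons replaced by points and the subfamily by an injective
    enumeration. *)
Definition antichain_in i μ P := exists f : O -> O,
  [/\ forall η, η < μ -> P (f η),
      forall ξ η, ξ < μ -> η < μ -> f ξ = f η -> ξ = η &
      forall ξ η, ξ < μ -> η < μ -> f ξ < f η -> i < c (f ξ) (f η)].

Lemma cardinal_one : cardinal (osucc \bot : O).
Proof.
move=> α; rewrite (lt_osuccE _ bot_lt_regular) lex0 => /eqP -> b1.
have : below (osucc \bot : O) #= (set0 : set O).
  rewrite (_ : set0 = below (\bot : O)); first exact: card_esym.
  by apply/seteqP; split=> x //=; rewrite /below /= ltx0.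
rewrite card_eq0 => /eqP b0; have : below (osucc \bot : O) \bot.
  by rewrite /below /= (lt_osuccE _ bot_lt_regular).
by rewrite b0.
Qed.

Lemma U_two_antichain μ i P : witnesses_U κ μ θ two c -> i < θ ->
  P `<=` below κ -> unbounded κ P -> antichain_in i μ P.
Proof.
move=> cU it Pk Pu.
pose A := (fun x : O => [set x]) @` P.
have AI : {in P &, injective (fun x : O => [set x])}.
  by move=> x y _ _ xy; have : [set x] x by []; rewrite xy.
have [||||B [BA Bm Bc]] := cU _ cardinal_one _ A _ _ _ i it.
- exact: lt_osucc one_lt_regular.
- move=> _ [x Px <-]; split; first by move=> y ->; exact: Pk.
  rewrite (_ : below (osucc \bot) = [set \bot]).
    by apply: (card_eq_trans card_set1); exact: card_esym card_set1.
  apply/seteqP; split=> y; rewrite /below /= (lt_osuccE _ bot_lt_regular) lex0.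
    by move/eqP.
  by move=> ->.
- by move=> _ _ [x _ <-] [y _ <-] [z [-> ->]].
- exact: card_eq_trans (inj_card_eq AI) (unbounded_card Pk Pu).
have [e [eB eI _]] := card_eq_enum set0 (card_esym Bm).
have /choice[f fP] : forall η, exists x, η < μ -> P x /\ e η = [set x].
  move=> η; have [em|] := boolP (η < μ); last by exists \bot.
  by have [x Px xe] := BA _ (eB _ em); exists x.
exists f; split.
- by move=> η /fP[].
- move=> ξ η xm em fe; apply: eI => //.
  by rewrite (fP _ xm).2 fe (fP _ em).2.
- move=> ξ η xm em fe; apply: (Bc (e ξ) (e η)).
  + exact: eB.
  + exact: eB.
  + by move=> α β; rewrite (fP _ xm).2 (fP _ em).2 => -> ->.
  + by rewrite (fP _ xm).2.
  + by rewrite (fP _ em).2.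
Qed.

Lemma antichain_U_two μ :
  (forall i P, i < θ -> P `<=` below κ -> unbounded κ P -> antichain_in i μ P) ->
  witnesses_U κ μ θ two c.
Proof.
move=> H; apply: witnesses_U_of_sequence => σ _ s2 A As At Ac i it.
have s1 : σ <= osucc \bot by move: s2; rewrite /two (lt_osuccE _ one_lt_regular).
have A1 a x y : A a -> a x -> a y -> x = y.
  move=> /As[_ /(card_eq_enum \bot)[e [es eI _]]] ax ay; apply: eI => //.
  have e0 z : a z -> e z = \bot.
    move=> /es ez; apply/eqP; rewrite -lex0 -(lt_osuccE _ bot_lt_regular).
    exact: lt_le_trans s1.
  by rewrite !e0.
pose P := [set x | A [set x]].
have AP a x : A a -> a x -> a = [set x].
  move=> Aa ax; apply/seteqP; split=> [y ay|_ ->//]; exact: (A1 a).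
have Pk : P `<=` below κ by move=> x /As[xk _]; exact: xk.
have Pu : unbounded κ P.
  move=> ε ek; have [a Aa ea] := family_unbounded At Ac ek.
  have [x ax] := family_nonempty As Ac Aa; exists x; last exact: ea.
  by rewrite /P /= -(AP a).
have [f [fP fI fc]] := H i P it Pk Pu.
exists (fun η => [set f η]); split.
- by move=> η /fP.
- move=> ξ η xm em xe; apply: fI => //.
  by have : [set f ξ] (f ξ) by []; rewrite xe.
- by move=> ξ η xm em xe α β -> ->; apply: fc => //; exact: xe.
Qed.


(** * The tree of a subadditive coloring *)

Section Subadditive.
Hypotheses (c_sub : subadditive κ c) (c_U : witnesses_U κ two θ two c).

Lemma color_trans i α β γ : α < β -> β < γ -> γ < κ ->
  c α β <= i -> c β γ <= i -> c α γ <= i.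
Proof.
move=> ab bg gk ci ci'; have [le_c _] := c_sub ab bg gk.
by apply: (le_trans le_c); rewrite ge_max ci ci'.
Qed.

Lemma color_tree i α β γ : α < β -> β < γ -> γ < κ ->
  c α γ <= i -> c β γ <= i -> c α β <= i.
Proof.
move=> ab bg gk ci ci'; have [_ le_c] := c_sub ab bg gk.
by apply: (le_trans le_c); rewrite ge_max ci ci'.
Qed.

Lemma no_large_chain i P : i < θ -> P `<=` below κ -> unbounded κ P ->
  exists α β, [/\ P α, P β, α < β & i < c α β].
Proof.
move=> it Pk Pu; have [f [fP fI fc]] := U_two_antichain c_U it Pk Pu.
have l1 : (osucc \bot : O) < two by exact: lt_osucc one_lt_regular.
have l01 : (\bot : O) < osucc \bot by exact: lt_osucc bot_lt_regular.
have l0 := lt_trans l01 l1.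
case: (ltgtP (f \bot) (f (osucc \bot))) => [f01|f10|fe].
- by exists (f \bot), (f (osucc \bot)); split; auto.
- by exists (f (osucc \bot)), (f \bot); split; auto.
- by move: l01; rewrite -(fI _ _ l0 l1 fe) ltxx.
Qed.

Section Tree.
Variables (i : O) (P : set O).
Hypotheses (i_lt : i < θ) (P_sub : P `<=` below κ) (P_unb : unbounded κ P).

(** The branch of [β] up to [δ] in the tree restricted to [P].  It replaces the
    levels of a tree, which would require ranks. *)
Definition trace δ β : set O := [set α | [/\ P α, α < δ & c α β <= i]].

(** Related points have the same predecessors below the smaller of them. *)
Lemma trace_incomparable δ α β : δ <= α -> α < β -> β < κ ->
  trace δ α <> trace δ β -> i < c α β.
Proof.
move=> da ab bk tne; rewrite ltNge; apply/negP => cab; apply: tne.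
apply/seteqP; split=> x [Px xd cx]; split=> //.
  by apply: (@color_trans i x α β) => //; exact: lt_le_trans da.
by apply: (@color_tree i x α β) => //; exact: lt_le_trans da.
Qed.

Lemma antichain_of_traces μ (f : O -> O) : (forall η, η < μ -> P (f η)) ->
  (forall ξ η, ξ < η -> η < μ -> exists2 δ, (δ <= f ξ) && (δ <= f η) &
     trace δ (f ξ) <> trace δ (f η)) -> antichain_in i μ P.
Proof.
move=> fP ft.
have ft' ξ η : ξ < μ -> η < μ -> ξ != η -> exists2 δ,
    (δ <= f ξ) && (δ <= f η) & trace δ (f ξ) <> trace δ (f η).
  move=> xm em; rewrite neq_lt => /orP[xe|ex]; first exact: ft.
  by have [δ ? tne] := ft _ _ ex xm; exists δ; [rewrite andbC|exact: nesym].
exists f; split=> // ξ η xm em fe.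
  apply/eqP; apply: contrapT => /negP xe; have [δ _] := ft' _ _ xm em xe.
  by rewrite fe.
have xe : ξ != η by apply/eqP => xe; move: fe; rewrite xe ltxx.
have [δ /andP[dx _] tne] := ft' _ _ xm em xe.
by apply: trace_incomparable tne => //; exact/P_sub/fP.
Qed.

Definition big δ b := unbounded κ [set β | [/\ P β, δ <= β & trace δ β = b]].

Section NoAntichain.
Variable μ : O.
Hypotheses (μ_lt : μ < κ) (no_antichain : ~ antichain_in i μ P).

(** If no trace below δ were shared by unboundedly many points, then a sequence
    of length κ could be chosen with each trace exhausted before the next point:
    its traces are distinct, so it is an antichain. *)
Lemma exists_big δ : δ < κ -> exists2 β, P β & δ <= β /\ big δ (trace δ β).
Proof.
move=> dk; apply: contrapT => nbig; apply: no_antichain.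
have /choice[k kP] : forall b, exists ε, ε < κ /\ forall β, P β -> δ <= β ->
    trace δ β = b -> β <= ε.
  move=> b; have nb : ~ big δ b.
    move=> bb; have [β [Pb db tb] _] := bb _ bot_lt_regular.
    by apply: nbig; exists β => //; rewrite tb.
  have [ε ek eP] := not_unbounded nb; exists ε; split=> // β Pb db tb.
  by apply: eP.
have [||f [fP finc]] := @increasing_sequence O \bot κ
    [set β | P β /\ δ <= β] id (fun β => k (trace δ β)) κ_cof.
- by move=> β _; case: (kP (trace δ β)).
- move=> ε ek; have ek' : Order.max ε δ < κ by rewrite gt_max ek dk.
  have [β Pb] := P_unb ek'; rewrite gt_max => /andP[eb db].
  by exists β => //; split=> //; exact: ltW.
apply: (@antichain_of_traces μ f).
  by move=> η /lt_trans/(_ μ_lt)/fP[].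
move=> ξ η xe em; have ek := lt_trans em μ_lt; have xk := lt_trans xe ek.
have [Pe de] := fP _ ek; have [_ dx] := fP _ xk.
exists δ; first by rewrite dx de.
move=> tt; have [_ kk] := kP (trace δ (f ξ)).
have := kk _ Pe de (esym tt); rewrite leNgt; apply/negP/negPn.
exact: finc.
Qed.

Definition splits δ b s := exists β0 β1,
  [/\ P β0 /\ P β1, trace δ β0 = b /\ trace δ β1 = b, s <= β0 /\ s <= β1 &
      trace s β0 <> trace s β1].

(** Let Q be the set of points above δ with trace b.  If b never splits, then a
    point α of Q lies below all later points of Q or below none, as is seen from
    the traces just above α.  The points of the first kind form a chain, those of
    the second kind an antichain, and one of the two kinds is unbounded. *)
Lemma big_splits δ b : δ < κ -> big δ b ->
  exists s, [/\ s < κ, δ <= s & splits δ b s].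
Proof.
move=> dk bb; apply: contrapT => nsplit.
pose Q := [set β | [/\ P β, δ <= β & trace δ β = b]].
have same α β0 β1 : Q α -> Q β0 -> Q β1 -> α < β0 -> α < β1 ->
    c α β0 <= i -> c α β1 <= i.
  move=> [Pa da _] [P0 d0 t0] [P1 d1 t1] a0 a1 ca0.
  have ak : α < κ by exact: P_sub.
  have : trace (osucc α) β0 = trace (osucc α) β1.
    apply: contrapT => tne; apply: nsplit; exists (osucc α).
    split; first exact: osucc_lt_regular.
      exact: le_trans da (ltW (lt_osucc ak)).
    by exists β0, β1; split=> //; split=> //; exact: osucc_lub.
  move=> tt; have : trace (osucc α) β0 α by split=> //; exact: lt_osucc ak.
  by rewrite tt => -[].
have Qk : Q `<=` below κ by move=> β [Pb _ _]; exact: P_sub.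
pose G := [set α | Q α /\ forall β, Q β -> α < β -> c α β <= i].
have [Gu|/not_unbounded[ε ek Ge]] := pselect (unbounded κ G).
  have [|α [β [[_ aP] [Qb _] ab]]] := no_large_chain i_lt _ Gu.
    by move=> α [/Qk].
  by rewrite ltNge aP.
apply: no_antichain; pose Q' := [set α | Q α /\ ε < α].
have [||f [fP finc]] := @unbounded_enum Q'.
- by move=> α [/Qk].
- move=> ε' ek'; have ek'' : Order.max ε ε' < κ by rewrite gt_max ek ek'.
  by have [β Qb] := bb _ ek''; rewrite gt_max => /andP[eb e'b]; exists β.
have finc' ξ η : ξ < η -> η < μ -> f ξ < f η.
  by move=> xe em; apply: finc => //; exact: lt_trans μ_lt.
exists f; split; last move=> ξ η xm em fe.
- by move=> η /lt_trans/(_ μ_lt)/fP[[]].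
- exact: increasing_inj finc'.
- have [Qx ex] := fP _ (lt_trans xm μ_lt).
  have [Qe _] := fP _ (lt_trans em μ_lt).
  rewrite ltNge; apply/negP => cxe.
  suff /Ge : G (f ξ) by rewrite leNgt ex.
  by split=> // β Qb xb; exact: same cxe.
Qed.

(** If the splitting levels had no common bound, unboundedly many different
    traces below δ would occur, hence a large antichain. *)
Lemma split_bound δ : δ < κ -> exists δ', [/\ δ' < κ, δ <= δ' &
  forall b, big δ b -> exists s, [/\ δ <= s, s <= δ' & splits δ b s]].
Proof.
move=> dk; apply: contrapT => nb; apply: no_antichain.
have /choice[s sP] : forall b, exists s, big δ b ->
    [/\ s < κ, δ <= s & splits δ b s].
  move=> b; have [bb|] := pselect (big δ b); last by exists \bot.
  by have [s sP] := big_splits dk bb; exists s.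
have [||f [fP finc]] := @increasing_sequence (set O) set0 κ (big δ) s s κ_cof.
- by move=> b /sP[].
- move=> ε ek; apply: contrapT => ne; apply: nb; exists (Order.max δ ε).
  split; [by rewrite gt_max dk ek|by rewrite le_max lexx|].
  move=> b bb; have [sk ds ss] := sP _ bb; exists (s b); split=> //.
  by rewrite le_max leNgt; apply/orP; right; rewrite leNgt; apply/negP => es;
    apply: ne; exists b.
have /choice[g gP] : forall η, exists β, η < κ ->
    [/\ P β, δ <= β & trace δ β = f η].
  move=> η; have [ek|] := boolP (η < κ); last by exists \bot.
  by have [β Qb _] := fP _ ek _ bot_lt_regular; exists β.
apply: (@antichain_of_traces μ g).
  by move=> η /lt_trans/(_ μ_lt)/gP[].
move=> ξ η xe em; have ek := lt_trans em μ_lt; have xk := lt_trans xe ek.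
have [_ de te] := gP _ ek; have [_ dx tx] := gP _ xk.
exists δ; first by rewrite dx de.
rewrite te tx => fe; have := finc _ _ xe ek.
by rewrite fe ltxx.
Qed.

(** The core of part (1).  The levels [D ξ], for ξ < μ, are spaced by
    [split_bound], [β] is a point above them with a big trace, and the ξ-th term of
    the antichain leaves the branch of [β] between [D ξ] and the next level. *)
Lemma small_antichain_contradiction : False.
Proof.
have /choice[k kP] : forall δ, exists δ', δ < κ -> [/\ δ' < κ, δ <= δ' &
    forall b, big δ b -> exists s, [/\ δ <= s, s <= δ' & splits δ b s]].
  move=> δ; have [dk|] := boolP (δ < κ); last by exists \bot.
  by have [δ' ?] := split_bound dk; exists δ'.
have [||D [DP Dinc]] := @increasing_sequence O \bot κ (below κ) id k κ_cof.
- by move=> δ /kP[].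
- by move=> ε ek; exists (osucc ε); [exact: osucc_lt_regular|exact: lt_osucc ek].
have [|δ dk Dd] := @regular_bounded μ D μ_lt.
  by move=> η /lt_trans/(_ μ_lt)/DP.
have [β Pb [db bb]] := exists_big dk.
have trD ξ α α' : trace δ α = trace δ α' -> ξ <= δ -> trace ξ α = trace ξ α'.
  move=> tt xd; have sub : forall a a', trace δ a = trace δ a' ->
      trace ξ a `<=` trace ξ a'.
    move=> a a' taa x [Px xx cx].
    have : trace δ a x by split=> //; exact: lt_le_trans xd.
    by rewrite taa => -[].
  by apply/seteqP; split; exact: sub.
(* [p.1] is the term of the antichain, [p.2] the level at which it has left the
   branch of [β]; of two points that split, one has left it. *)
have /choice[f fP] : forall ξ, exists p : O * O, ξ < μ ->
    [/\ P p.1, D ξ <= p.2 <= k (D ξ), p.2 <= p.1,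
        trace (D ξ) p.1 = trace (D ξ) β & trace p.2 p.1 <> trace p.2 β].
  move=> ξ; have [xm|] := boolP (ξ < μ); last by exists (\bot, \bot).
  have xk := lt_trans xm μ_lt; have Dk := DP _ xk.
  have bD : big (D ξ) (trace (D ξ) β).
    move=> ε ek; have [γ [Pg dg tg] eg] := bb _ ek; exists γ => //; split=> //.
      exact: le_trans (ltW (Dd _ xm)) dg.
    exact: (trD _ _ _ tg (ltW (Dd _ xm))).
  have [_ _ /(_ _ bD)[s [Ds sk [β0 [β1 [[P0 P1] [t0 t1] [s0 s1] tne]]]]]] :=
    kP _ Dk.
  have [t0b|t0b] := pselect (trace s β0 = trace s β).
    exists (β1, s) => _; split=> //=; first by rewrite Ds.
    by rewrite -t0b; exact: nesym.
  by exists (β0, s) => _; split=> //=; rewrite Ds.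
apply: no_antichain; apply: (@antichain_of_traces μ (fun ξ => (f ξ).1)).
  by move=> η /fP[].
move=> ξ η xe em; have xm := lt_trans xe em.
have [Px /andP[_ sx] sfx _ tnx] := fP _ xm.
have [Pe /andP[Ds _] sfe te _] := fP _ em.
have sD : (f ξ).2 <= D η.
  by apply: (le_trans sx); apply/ltW/Dinc => //; exact: lt_trans μ_lt.
exists (f ξ).2; first by rewrite sfx (le_trans sD) // (le_trans Ds).
move=> tt; apply: tnx; rewrite tt.
apply/seteqP; split=> x [Px' xs cx]; split=> //.
- have : trace (D η) (f η).1 x by split=> //; exact: lt_le_trans sD.
  by rewrite te => -[].
- have : trace (D η) β x by split=> //; exact: lt_le_trans sD.
  by rewrite -te => -[].
Qed.

End NoAntichain.

Lemma small_antichain μ : μ < κ -> antichain_in i μ P.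
Proof. by move=> mk; apply: contrapT => /(small_antichain_contradiction mk). Qed.

End Tree.

(** * Souslin trees and part (1) *)

Section SouslinTree.
Variables (i : O) (P : set O).
Hypotheses (i_lt : i < θ) (P_sub : P `<=` below κ) (P_unb : unbounded κ P).

Definition node := {x : O | P x}.
Definition node_lt (x y : node) := sval x < sval y /\ c (sval x) (sval y) <= i.

Lemma node_card (A : set node) : sval @` A #= A.
Proof. by apply: inj_card_eq => -[x Px] [y Py] _ _ /= xy; exact: eq_exist. Qed.

Lemma node_souslin : ~ antichain_in i κ P -> souslin_tree node_lt κ.
Proof.
move=> nanti; split.
- split=> [x []|x y z [xy cxy] [yz cyz]|x A Ax [y0 Ay0]].
  + by rewrite ltxx.
  + split; first exact: lt_trans yz.
    exact: (color_trans xy yz (P_sub (svalP z)) cxy cyz).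
  + have [|_ [m Am <-] mle] := @exists_least (sval @` A).
      by exists (sval y0), y0.
    exists m => // y Ay.
    have : sval m <= sval y by apply: mle; exists y.
    rewrite le_eqVlt => /orP[/eqP my|my]; [left|right; split=> //].
      by case: y m my {mle Ay Am} => [y Py] [m Pm] /= my; exact: eq_exist.
    have [yx cyx] := Ax _ Ay; have [mx cmx] := Ax _ Am.
    exact: (color_tree my yx (P_sub (svalP x)) cmx cyx).
- apply: card_eq_trans (unbounded_card P_sub P_unb).
  apply: (card_eq_trans (card_esym (node_card _))).
  rewrite (_ : sval @` _ = P) //; apply/seteqP; split=> [_ [x _ <-]|x Px].
    exact: svalP.
  by exists (exist _ x Px).
- move=> A Ach Ak.
  have Ask : sval @` A `<=` below κ by move=> _ [x _ <-]; exact/P_sub/svalP.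
  have Asu : unbounded κ (sval @` A).
    apply: card_unbounded => //; move: (card_eq_trans (node_card A) Ak).
    by rewrite card_eq_le => /andP[].
  have [_ [_ [[x Ax <-] [y Ay <-] xy]]] := no_large_chain i_lt Ask Asu.
  rewrite ltNge; case: (Ach _ _ Ax Ay) => [xye|[_ ->//]|[yx _]].
    by move: xy; rewrite xye ltxx.
  by have := lt_trans xy yx; rewrite ltxx.
- move=> A Aanti /card_esym Ak; apply: nanti.
  have [p0 Pp0 _] := P_unb bot_lt_regular.
  have [e [eA eI _]] := card_eq_enum (exist _ p0 Pp0 : node) Ak.
  exists (fun η => sval (e η)); split.
  + by move=> η _; exact: svalP.
  + move=> ξ η xk ek xe; apply: eI => //.
    by move: xe; case: (e ξ) => x Px; case: (e η) => y Py /= xy; exact: eq_exist.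
  + move=> ξ η xk ek xe; rewrite ltNge; apply/negP => cxe.
    have [|+ _] := Aanti _ _ (eA _ xk) (eA _ ek).
      by move=> ee; move: xe; rewrite ee ltxx.
    by apply.
Qed.

End SouslinTree.

Lemma U_two_below μ : μ < κ -> witnesses_U κ μ θ two c.
Proof.
by move=> mk; apply: antichain_U_two => i P it Pk Pu; exact: small_antichain.
Qed.

Lemma U_two_no_souslin :
  ~ (exists (T : Type) (lt : T -> T -> Prop), souslin_tree lt κ) ->
  witnesses_U κ κ θ two c.
Proof.
move=> nS; apply: antichain_U_two => i P it Pk Pu; apply: contrapT => na.
by apply: nS; exists (node P), (@node_lt i P); exact: node_souslin.
Qed.

(** * Part (2) *)

Hypotheses (θ_lt : θ < κ) (c_col : coloring κ θ c).

(** Let γ < γ' have c(γ,γ') > j, with attached sets a and a', and let α be in a,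
    β in a', so that γ < α < γ' < β.  If c(α,β) <= i <= j then c(γ,β) <= j by
    transitivity, since c(γ,α) <= j; as c(γ',β) <= j, the tree property gives
    c(γ,γ') <= j, a contradiction. *)
Lemma U_cofinality μ : μ <= κ -> witnesses_U κ μ θ two c ->
  witnesses_U κ μ θ (cof θ) c.
Proof.
move=> mk cU; apply: witnesses_U_of_sequence => σ _ sc A As At Ac i it.
have sk : σ < κ by apply: (lt_trans (lt_le_trans sc (cof_le θ))).
have /choice[hi hiP] : forall a, exists ε, A a ->
    ε < κ /\ forall α, a α -> α < ε.
  move=> a; have [Aa|] := pselect (A a); last by exists \bot.
  by have [ε ek ae] := family_bounded sk As Aa; exists ε.
(* The sets [a] attached to γ, with [c γ] at most [j] on [a]. *)
pose Q j := [set p : O * set O | [/\ A p.2, p.1 < κ &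
  forall α, p.2 α -> p.1 < α /\ c p.1 α <= j]].
have [j [jt ij Qu]] : exists j, [/\ j < θ, i <= j &
    forall ε, ε < κ -> exists2 p, Q j p & ε < p.1].
  apply: contrapT => nj.
  have /choice[k kP] : forall j, exists ε, j < θ ->
      ε < κ /\ (i <= j -> forall p, Q j p -> p.1 <= ε).
    move=> j; have [jt|] := boolP (j < θ); last by exists \bot.
    have [ij|] := boolP (i <= j); last by exists \bot; rewrite bot_lt_regular.
    apply: contrapT => nk; apply: nj; exists j; split=> // ε ek.
    apply: contrapT => np; apply: nk; exists ε => _; split=> // _ p Qp.
    by rewrite leNgt; apply/negP => ep; apply: np; exists p.
  have [|ε ek kε] := @regular_bounded θ k θ_lt; first by move=> j /kP[].
  have [a Aa ea] := family_unbounded At Ac ek.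
  have [|j0 j0t cj0] := @family_bounded_in _ _ As θ a (c ε) sc Aa.
    by move=> α aα; apply: c_col; [exact: ea|case: (As _ Aa) => + _; exact].
  have jt : Order.max i j0 < θ by rewrite gt_max it j0t.
  have imax : i <= Order.max i j0 by rewrite le_max lexx.
  have [_ /(_ imax (ε, a)) kQ] := kP _ jt.
  suff : Q (Order.max i j0) (ε, a) by move=> /kQ; rewrite leNgt (kε _ jt).
  split=> // α aα; split; first exact: ea.
  by rewrite le_max (ltW (cj0 _ aα)) orbT.
have [||f [fQ finc]] := @increasing_sequence (O * set O) (\bot, set0) κ (Q j)
   fst (fun p => hi p.2) κ_cof.
- by move=> p [/hiP[]].
- exact: Qu.
pose γ η := (f η).1; pose a η := (f η).2.
have aA η : η < κ -> A (a η) by move=> /fQ[].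
have a0 η : η < κ -> a η !=set0 by move=> /aA; exact: (family_nonempty As Ac).
have ga η α : η < κ -> a η α -> γ η < α /\ c (γ η) α <= j.
  by move=> /fQ[_ _ H] /H.
have ag ξ η α : ξ < η -> η < κ -> a ξ α -> α < γ η.
  move=> xe ek aα; apply: lt_trans (finc _ _ xe ek).
  by have [_] := hiP _ (aA _ (lt_trans xe ek)); exact.
have alt ξ η : ξ < η -> η < κ -> set_lt (a ξ) (a η).
  move=> xe ek α β aα bβ; apply: lt_trans (ag _ _ _ xe ek aα) _.
  by have [] := ga _ _ ek bβ.
have ginc ξ η : ξ < η -> η < κ -> γ ξ < γ η.
  move=> xe ek; have [α aα] := a0 _ (lt_trans xe ek).
  by apply: lt_trans (ag _ _ _ xe ek aα); have [] := ga _ _ (lt_trans xe ek) aα.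
pose Γ := γ @` below κ.
have Γk : Γ `<=` below κ by move=> _ [η /fQ[_ gk _] <-].
have Γu : unbounded κ Γ.
  apply: card_unbounded => //; apply: (@card_le_inj _ _ _ _ γ).
    by move=> η ek; exists η.
  exact: increasing_inj.
have [e [eΓ eI ec]] := U_two_antichain cU jt Γk Γu.
have /choice[n nP] : forall η, exists ν, η < μ -> ν < κ /\ γ ν = e η.
  move=> η; have [/eΓ[ν nk ne]|] := boolP (η < μ); last by exists \bot.
  by exists ν.
exists (a \o n); split=> /=.
- by move=> η /nP[nk _]; exact: aA.
- move=> ξ η xm em; have [xk xe] := nP _ xm; have [ek ee] := nP _ em.
  by move=> /(set_lt_injective a0 alt xk ek) ne; apply: eI => //; rewrite -xe -ee ne.
- move=> ξ η xm em; have [xk xe] := nP _ xm; have [ek ee] := nP _ em.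
  move=> /(set_lt_index a0 alt xk ek) nlt α β aα bβ.
  have [ga1 ga2] := ga _ _ xk aα; have [gb1 gb2] := ga _ _ ek bβ.
  have ag1 := ag _ _ _ nlt ek aα.
  have bk : β < κ by have [+ _] := As _ (aA _ ek); exact.
  have cg : j < c (γ (n ξ)) (γ (n η)) by rewrite xe ee ec // -xe -ee ginc.
  apply: (le_lt_trans ij); rewrite ltNge; apply/negP => cab.
  have cgb : c (γ (n ξ)) β <= j.
    by apply: (color_trans ga1 _ bk ga2 cab); exact: lt_trans ag1 gb1.
  by move: cg; rewrite ltNge (color_tree (ginc _ _ nlt ek) gb1 bk cgb gb2).
Qed.
End Subadditive.
End Coloring.
End RegularCardinal.

(** * Part (3) *)

Section ClosedColoring.
Variables (κ θ χ : O) (c : O -> O -> O) (S : set O).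
Hypotheses (κ_regular : infinite_regular_cardinal κ)
  (κ_uncountable : ~ countable (below κ))
  (c_sub : subadditive κ c) (c_U : witnesses_U κ two θ two c)
  (χ_regular : infinite_regular_cardinal χ) (χ_lt : χ < κ)
  (S_E : S `<=` E_ge κ χ) (S_stat : stationary κ S)
  (S_closed : closed_for κ θ S c).

(** Closedness puts γ among the predecessors of β when these are cofinal in γ,
    provided that one of them is at least γ: accumulation points of a set are
    taken below its strict supremum. *)
Lemma closed_limit i γ β x : i < θ -> β < κ -> S γ ->
  (forall ε, ε < γ -> exists y, [/\ ε < y, y < γ & c y β <= i]) ->
  γ <= x -> x < β -> c x β <= i -> γ < β /\ c γ β <= i.
Proof.
move=> it bk Sg cofinal gx xb cx; have gb := le_lt_trans gx xb.
apply: (S_closed bk (ltW it)); split=> //; split; last split.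
- have [|ub _] := @osup_lub (osucc @` D_le c i β) β.
    by move=> _ [y [yb _] <-]; exact: osucc_lub.
  apply: (le_lt_trans gx); apply: (lt_le_trans (lt_osucc xb)); apply: ub.
  by exists x.
- apply: osup_unique => [y [_ /ltW]//|b bub]; rewrite leNgt; apply/negP => bg.
  have [y [by_ yg cy]] := cofinal _ bg.
  suff /bub : (D_le c i β `&` below γ) y by rewrite leNgt by_.
  by split=> //; split=> //; exact: lt_trans gb.
- have [_ cg] := S_E Sg; apply: (lt_le_trans (bot_lt_regular χ_regular)).
  exact: le_trans cg (cof_le γ).
Qed.

Section Family.
Variables (σ i : O) (A : set (set O)).
Hypotheses (σ_lt : σ < χ) (i_lt : i < θ) (A_sub : A `<=` subsets_of_card κ σ)
  (A_triv : trivIset A id) (A_card : A #= below κ).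

(** The member [a] of the family lies above [γ], and the tree predecessors of its
    points avoid the interval between [ε] and [γ]. *)
Definition avoids γ ε a := [/\ A a, forall α, a α -> γ < α &
  forall α x, a α -> x < γ -> c x α <= i -> x <= ε].

(** Otherwise there are χ many exceptional points [e η], pairwise unrelated, and a
    member [a] of the family above them.  Since cf(e η) exceeds the size of [a],
    the predecessors of some [t η] in [a] are cofinal in [e η].  Say that η is in
    [X] if [t η] also has a predecessor at or above [e η].  When e ξ < e η and
    t ξ = t η, the index ξ is in [X], and η is not, as otherwise [closed_limit]
    makes both e ξ and e η predecessors of t η, hence related.  So [t] is
    injective on [X] and on its complement, and one of these has size χ. *)
Lemma avoids_tail : exists2 ρ, ρ < κ &
  forall γ, S γ -> ρ < γ -> exists2 ε, ε < γ & exists a, avoids γ ε a.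
Proof.
pose P := [set γ | S γ /\ ~ exists2 ε, ε < γ & exists a, avoids γ ε a].
suff /(not_unbounded)[ρ rk rP] : ~ unbounded κ P.
  exists ρ => // γ Sg rg; apply: contrapT => na.
  by have := rP γ (conj Sg na); rewrite leNgt rg.
move=> Pu; have Pk : P `<=` below κ by move=> γ [/S_E[]].
have [e [eP eI ec]] :=
  small_antichain κ_regular c_sub c_U i_lt Pk Pu χ_lt.
have [|ε ek eε] := regular_bounded κ_regular χ_lt (f := e).
  by move=> η /eP /Pk.
have [a Aa εa] := family_unbounded κ_regular A_triv A_card ek.
have ak α : a α -> α < κ by move=> aα; have [+ _] := A_sub Aa; exact.
have /choice[t tP] : forall η, exists α, η < χ -> a α /\
    forall ε, ε < e η -> exists y, [/\ ε < y, y < e η & c y α <= i].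
  move=> η; have [ec'|] := boolP (η < χ); last by exists \bot.
  apply: contrapT => nα; have [Se []] := eP _ ec'.
  have /choice[f fP] : forall α, exists ε, a α -> ε < e η /\
      forall x, x < e η -> c x α <= i -> x <= ε.
    move=> α; have [aα|] := pselect (a α); last by exists \bot.
    apply: contrapT => nε; apply: nα; exists α => _; split=> // ε' e'.
    apply: contrapT => ny; apply: nε; exists ε' => _; split=> // x xe cx.
    by rewrite leNgt; apply/negP => ex; apply: ny; exists x.
  have sc : σ < cof (e η) by apply: lt_le_trans σ_lt _; case: (S_E Se).
  have [|ε' e'e fe] := family_bounded_in A_sub sc Aa (f := f).
    by move=> α /fP[].
  exists ε' => //; exists a; split=> // [α aα|α x aα xe cx].
    exact: lt_trans (eε _ ec') (εa _ aα).
  have [_ H] := fP _ aα; exact: le_trans (H _ xe cx) (ltW (fe _ aα)).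
have et η : η < χ -> e η < t η.
  by move=> ec'; have [ta _] := tP _ ec'; exact: lt_trans (eε _ ec') (εa _ ta).
pose X := [set η | exists x, [/\ e η <= x, x < t η & c x (t η) <= i]].
have sep ξ η : ξ < χ -> η < χ -> t ξ = t η -> e ξ < e η -> X ξ /\ ~ X η.
  move=> xc ec' txe xe; have [tx _] := tP _ xc; have [te cofe] := tP _ ec'.
  have Xx : X ξ.
    have [y [xy ye cy]] := cofe _ xe; exists y; split; rewrite ?txe //.
      exact: ltW.
    exact: lt_trans (et _ ec').
  split=> // -[y [ey yt cy]]; have [x [ex xt cx]] := Xx.
  have [Sx _] := eP _ xc; have [Se _] := eP _ ec'.
  have [_ cofx] := tP _ xc.
  have [_ cxt] := closed_limit i_lt (ak _ tx) Sx cofx ex xt cx.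
  have [et' cet] := closed_limit i_lt (ak _ te) Se cofe ey yt cy.
  have := ec _ _ xc ec' xe; rewrite ltNge.
  by rewrite (color_tree c_sub xe et' (ak _ te) _ cet) // -txe.
have tI Y : (forall η, Y η -> η < χ) ->
    (forall ξ η, Y ξ -> Y η -> X ξ -> X η) ->
    forall ξ η, Y ξ -> Y η -> t ξ = t η -> ξ = η.
  move=> Yc YX ξ η Yx Ye txe; apply: eI; [exact: Yc|exact: Yc|].
  case: (ltgtP (e ξ) (e η)) => // xe.
    by have [Xx []] := sep _ _ (Yc _ Yx) (Yc _ Ye) txe xe; exact: YX Xx.
  by have [Xx []] := sep _ _ (Yc _ Ye) (Yc _ Yx) (esym txe) xe; exact: YX Xx.
have [_ aσ] := A_sub Aa.
have [Xu|Xu] := unbounded_split χ_regular X.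
- apply: (unbounded_not_card_le χ_regular _ Xu σ_lt aσ (f := t)).
  + by move=> η [].
  + by move=> η [/tP[]].
  + by apply: tI => [η []|ξ η _ []].
- apply: (unbounded_not_card_le χ_regular _ Xu σ_lt aσ (f := t)).
  + by move=> η [].
  + by move=> η [/tP[]].
  + by apply: tI => [η []|ξ η [_ nX] _ /nX].
Qed.

Lemma avoids_uniform : exists2 ε, ε < κ &
  unbounded κ [set γ | ε < γ /\ exists a, avoids γ ε a].
Proof.
have [ρ rk rP] := avoids_tail.
have /choice[f fP] : forall γ, exists ε, S γ -> ρ < γ ->
    ε < γ /\ exists a, avoids γ ε a.
  move=> γ; have [Sg|] := pselect (S γ); last by exists \bot.
  have [rg|] := boolP (ρ < γ); last by exists \bot.
  by have [ε eg aP] := rP _ Sg rg; exists ε.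
have [|ε ek εu] := @pressing_down_bounded _ κ_regular κ_uncountable S ρ f S_stat rk.
  by move=> γ Sg rg; case: (fP _ Sg rg).
exists ε => // ζ zk; have mk : Order.max ζ ε < κ by rewrite gt_max zk ek.
have [γ [Sg rg fε]] := εu _ mk; rewrite gt_max => /andP[zg eg].
exists γ => //; split=> //; have [_ [a [Aa ga fa]]] := fP _ Sg rg.
by exists a; split=> // α x aα xg cx; exact: le_trans (fa _ _ aα xg cx) fε.
Qed.

End Family.

Lemma U_closed : witnesses_U κ κ θ χ c.
Proof.
apply: witnesses_U_of_sequence => σ _ sc A As At Ac i it.
have sk := lt_trans sc χ_lt.
have [ε ek εu] := avoids_uniform sc it As At Ac.
have /choice[hi hiP] : forall a, exists ζ, A a ->
    ζ < κ /\ forall α, a α -> α < ζ.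
  move=> a; have [Aa|] := pselect (A a); last by exists \bot.
  by have [ζ zk ae] := family_bounded κ_regular sk As Aa; exists ζ.
have [_ _ κ_cof] := κ_regular.
have [||f [fP finc]] := @increasing_sequence (O * set O) (\bot, set0) κ
    [set p | ε < p.1 /\ avoids i A p.1 ε p.2] fst (fun p => hi p.2) κ_cof.
- by move=> p [_ [/hiP[]]].
- by move=> ζ /εu[γ [eg [a ga]] zg]; exists (γ, a).
pose a η := (f η).2.
have aA η : η < κ -> A (a η) by move=> /fP[_ []].
have a0 η : η < κ -> a η !=set0.
  by move=> /aA; exact: (family_nonempty κ_regular As Ac).
have ag ξ η α : ξ < η -> η < κ -> a ξ α -> α < (f η).1.
  move=> xe ek' aα; apply: lt_trans (finc _ _ xe ek').
  by have [_] := hiP _ (aA _ (lt_trans xe ek')); exact.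
have alt ξ η : ξ < η -> η < κ -> set_lt (a ξ) (a η).
  move=> xe ek' α β aα bβ; apply: lt_trans (ag _ _ _ xe ek' aα) _.
  by have [_ [_ + _]] := fP _ ek'; exact.
exists a; split=> //; first exact: set_lt_injective.
move=> ξ η xk ek' /(set_lt_index a0 alt xk ek') xe α β aα bβ.
have [eg [_ ga _]] := fP _ xk; have [_ [_ _ gb]] := fP _ ek'.
rewrite ltNge; apply/negP => cab.
have := gb _ _ bβ (ag _ _ _ xe ek' aα) cab.
by rewrite leNgt (lt_trans eg (ga _ aα)).
Qed.

End ClosedColoring.
End Ordinals.

Theorem lemma3p2 (d : Order.disp_t) (O : bOrderType d)
    (wfO : well_order (<=%O : rel O))
    (κ θ : O) (c : O -> O -> O)
    (κ_regular : infinite_regular_cardinal κ)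
    (κ_uncountable : ~ countable (below κ))
    (θ_cardinal : cardinal θ) (θ_lt_κ : θ < κ)
    (c_coloring : coloring κ θ c)
    (c_subadditive : subadditive κ c)
    (c_U : witnesses_U κ two θ two c) :
  (* (1) *)
  ((forall μ : O, cardinal μ -> μ < κ -> witnesses_U κ μ θ two c) /\
   ((~ exists (T : Type) (lt : T -> T -> Prop), souslin_tree lt κ) ->
      witnesses_U κ κ θ two c)) /\
  (* (2) *)
  (forall μ : O, cardinal μ -> μ <= κ ->
     witnesses_U κ μ θ two c -> witnesses_U κ μ θ (cof θ) c) /\
  (* (3) *)
  (forall χ : O, infinite_regular_cardinal χ -> χ < κ ->
     (exists S : set O,
        [/\ S `<=` E_ge κ χ, stationary κ S & closed_for κ θ S c]) ->
     witnesses_U κ κ θ χ c).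
Proof.
split; [split|split].
- by move=> μ _; exact: U_two_below.
- exact: U_two_no_souslin.
- by move=> μ _; exact: U_cofinality.
- by move=> χ χ_regular χ_lt [S [S_E S_stat S_closed]]; exact: U_closed S_closed.
Qed.
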